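(* Let $A,J_1,\ldots,J_N\in\mathbb{R}^{n\times n}$ and let $0<T_{min}\le T_{max}<\infty$ be given. Assume that there exist matrices $P_i\in\mathbb{S}^n_{\succ0}$, $i=1,\ldots,N$, and a nonnegative matrix $\Pi=[\pi_{ij}]\in\mathbb{R}^{N\times N}$ verifying $\mathbf{1}_N^T\Pi=\mathbf{1}_N^T$ such that $$J_i^Te^{A^T\theta}\left(\sum_{j=1}^N\pi_{ji}P_j\right)e^{A\theta}J_i-P_i\prec0$$ holds for all $i=1,\ldots,N$ and all $\theta\in[T_{min},T_{max}]$. Then there exist $\varepsilon>0$ and $d\in\mathbb{Z}_{\ge0}$ such that the following sum of squares program is feasible using polynomial matrices of degree (at most) $2d$: find symmetric matrix-valued polynomial functions $S_i,\Gamma_i,\Delta_i:\mathbb{R}\to\mathbb{S}^n$, constant matrices $P_i\in\mathbb{S}^n$, $i=1,\ldots,N$, and a nonnegative matrix $\Pi=[\pi_{ij}]\in\mathbb{R}^{N\times N}$ with $\mathbf{1}_N^T\Pi=\mathbf{1}_N^T$ such that, for all $i=1,\ldots,N$: - $\Gamma_i(\cdot)$ and $\Delta_i(\cdot)$ are SOS matrices, - $P_i-\varepsilon I$ is an SOS matrix, - $\dot{S}_i(\tau)-\big(S_i(\tau)A+A^TS_i(\tau)\big)-\Gamma_i(\tau)g(\tau)$ is an SOS matrix (in $\tau$), - $P_i-J_i^TS_i(\theta)J_i-\varepsilon I-\Delta_i(\theta)h(\theta)$ is an SOS matrix (in $\theta$), - $-\sum_{j=1}^N\pi_{ji}P_j+S_i(0)$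 is an SOS matrix.
   Context: $\mathbb{S}^{n}$ is the set of real symmetric $n\times n$ matrices, $\mathbb{S}^{n}_{\succ0}$ the positive definite ones; $X\prec0$ means negative definite. $\mathbf{1}_N$ is the $N$-vector of ones. A nonnegative matrix is a matrix with nonnegative entries. $\dot S_i$ is the derivative of $S_i$ with respect to its argument. The polynomials $g,h$ are $$g(\tau):=\tau(T_{max}-\tau),\qquad h(\theta):=(\theta-T_{min})(T_{max}-\theta).$$ A symmetric (univariate, real) polynomial matrix $\Theta(\cdot)$ is called a sum of squares (SOS) matrix if there exists a (not necessarily square) polynomial matrix $\Xi(\cdot)$ such that $\Theta(\cdot)=\Xi(\cdot)^T\Xi(\cdot)$; a constant matrix is regarded as a polynomial matrix of degree zero. ''Using polynomial matrices of degree (at most) $2d$'' refers to the unknown polynomial matrices $S_i,\Gamma_i,\Delta_i$. *)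

(* Defs.v *)
From HB Require Import structures.
From mathcomp Require Import all_boot all_order all_algebra.
From mathcomp Require Import all_classical all_reals all_analysis.

Set Implicit Arguments.
Unset Strict Implicit.
Unset Printing Implicit Defensive.

Import Order.TTheory GRing.Theory Num.Theory.
Import numFieldNormedType.Exports.

Local Open Scope classical_set_scope.
Local Open Scope ring_scope.

Definition symmx (K : nzRingType) (n : nat) (X : 'M[K]_n) : Prop := X^T = X.

Definition posdefmx (R : realType) (n : nat) (X : 'M[R]_n) : Prop :=
  symmx X /\ forall x : 'cV[R]_n, x != 0 -> 0 < (x^T *m X *m x) 0 0.

Definition negdefmx (R : realType) (n : nat) (X : 'M[R]_n) : Prop :=
  symmx X /\ forall x : 'cV[R]_n, x != 0 -> (x^T *m X *m x) 0 0 < 0.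

Definition nonnegmx (R : realType) (m n : nat) (X : 'M[R]_(m, n)) : Prop :=
  forall i j, 0 <= X i j.

(* The limit is taken in the library topology of 'M[R]_n (that of the max
   norm); the series always converges. *)
Definition expmx (R : realType) (n : nat) (X : 'M[R]_n) : 'M[R]_n :=
  limn (series (fun k : nat => (k`!%:R)^-1 *: X ^+ k)).

(* A polynomial matrix is a matrix with entries in {poly R}. *)
Definition constpmx (R : realType) (m n : nat) (X : 'M[R]_(m, n)) :
    'M[{poly R}]_(m, n) := map_mx polyC X.

Definition evalpmx (R : realType) (m n : nat) (X : 'M[{poly R}]_(m, n))
    (t : R) : 'M[R]_(m, n) := map_mx (fun p : {poly R} => p.[t]) X.

Definition derivpmx (R : realType) (m n : nat) (X : 'M[{poly R}]_(m, n)) :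
    'M[{poly R}]_(m, n) := map_mx (@deriv R) X.

(* size p = deg p + 1 for p != 0, and size 0 = 0 *)
Definition degpmx_le (R : realType) (m n : nat) (k : nat)
    (X : 'M[{poly R}]_(m, n)) : Prop :=
  forall i j, (size (X i j) <= k.+1)%N.

Definition sosmx (R : realType) (n : nat) (X : 'M[{poly R}]_n) : Prop :=
  exists (m : nat) (Xi : 'M[{poly R}]_(m, n)), X = Xi^T *m Xi.

Definition gpoly (R : realType) (Tmax : R) : {poly R} :=
  'X * (Tmax%:P - 'X).

Definition hpoly (R : realType) (Tmin Tmax : R) : {poly R} :=
  ('X - Tmin%:P) * (Tmax%:P - 'X).

Definition colstochmx (R : realType) (N : nat) (Pi : 'M[R]_N) : Prop :=
  nonnegmx Pi /\ (const_mx 1 : 'cV[R]_N)^T *m Pi = (const_mx 1 : 'cV[R]_N)^T.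

(* The degree bound concerns the unknowns S, Gamma and Delta only: the SOS
   factors are not bounded explicitly. *)
Definition sos_feasible (R : realType) (n N : nat) (A : 'M[R]_n)
    (J : 'I_N -> 'M[R]_n) (Tmin Tmax eps : R) (d : nat) : Prop :=
  exists (S Gamma Delta : 'I_N -> 'M[{poly R}]_n)
         (P : 'I_N -> 'M[R]_n) (Pi : 'M[R]_N),
    colstochmx Pi /\
    forall i : 'I_N,
      [/\ [/\ symmx (S i), symmx (Gamma i), symmx (Delta i) & symmx (P i)],
          [/\ degpmx_le (2 * d) (S i), degpmx_le (2 * d) (Gamma i)
            & degpmx_le (2 * d) (Delta i)],
          sosmx (Gamma i) /\ sosmx (Delta i)
        & [/\ sosmx (constpmx (P i - eps%:M)),
              sosmx (derivpmx (S i)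
                     - (S i *m constpmx A + (constpmx A)^T *m S i)
                     - gpoly Tmax *: Gamma i),
              sosmx (constpmx (P i)
                     - (constpmx (J i))^T *m S i *m constpmx (J i)
                     - constpmx eps%:M
                     - hpoly Tmin Tmax *: Delta i)
            & sosmx (constpmx (- (\sum_(j < N) Pi j i *: P j)
                               + evalpmx (S i) 0))]].

(* Main.v *)
Require Import Defs.
From mathcomp Require Import all_boot all_order all_algebra.
From mathcomp Require Import all_classical all_reals all_analysis.
From mathcomp Require Import ring lra zify.
Import Order.TTheory GRing.Theory Num.Theory.
Import numFieldNormedType.Exports.
Set Implicit Arguments.
Unset Strict Implicit.
Unset Printing Implicit Defensive.
Local Open Scope ring_scope.

(** The exact solution [S t = e^(A^T t) Q e^(A t)] of [S' = S A + A^T S],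
    [S 0 = Q], is replaced by its Taylor truncation plus
    [delta (1 + t)^K I].  For [K] large this term makes
    [S' - S A - A^T S] uniformly positive definite on [[0, Tmax]] as soon as
    the truncation order is large enough; for [delta] small it preserves the
    jump inequality, which is uniform in [theta] by compactness.

    A symmetric polynomial matrix [F] with [F >= c I] on [[a, b]], [a < b],
    equals [Sigma + (t - a)(b - t) Gamma] with [Sigma], [Gamma] SOS: the
    Bernstein coefficients of [F] of a large even order [m] are positive
    definite, hence of the form [M^T M], and [u^k (1 - u)^(m - k)] is a square
    for [k] even, [u (1 - u)] times a square for [k] odd. *)

(** * Quadratic forms, coercivity and Cholesky factors *)

Definition qform (R : realType) (n : nat) (X : 'M[R]_n) (x : 'cV[R]_n) : R :=
  (x^T *m X *m x) 0 0.

(** The Loewner inequality [X >= c I]: [qform 1%:M x] is the squared Euclidean norm of [x]. Symmetry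
    of [X] is kept as a separate condition. *)
Definition coercmx (R : realType) (n : nat) (c : R) (X : 'M[R]_n) : Prop :=
  forall x : 'cV[R]_n, c * qform 1%:M x <= qform X x.

Section QuadraticForms.
Variable R : realType.

Lemma qformE n (X : 'M[R]_n) x : qform X x = \sum_i \sum_j x i 0 * X i j * x j 0.
Proof.
rewrite /qform -mulmxA mxE; apply: eq_bigr => i _; rewrite mxE mxE mulr_sumr.
by apply: eq_bigr => j _; rewrite mulrA.
Qed.

Lemma qformD n (X Y : 'M[R]_n) x : qform (X + Y) x = qform X x + qform Y x.
Proof. by rewrite /qform mulmxDr mulmxDl mxE. Qed.

Lemma qformN n (X : 'M[R]_n) x : qform (- X) x = - qform X x.
Proof. by rewrite /qform mulmxN mulNmx mxE. Qed.

Lemma qformB n (X Y : 'M[R]_n) x : qform (X - Y) x = qform X x - qform Y x.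
Proof. by rewrite qformD qformN. Qed.

Lemma qformZ n c (X : 'M[R]_n) x : qform (c *: X) x = c * qform X x.
Proof. by rewrite /qform -scalemxAr -scalemxAl mxE. Qed.

Lemma qform_conj m n (M : 'M[R]_(m, n)) (Y : 'M[R]_m) x :
  qform (M^T *m Y *m M) x = qform Y (M *m x).
Proof. by rewrite /qform trmx_mul !mulmxA. Qed.

Lemma qform1 n (x : 'cV[R]_n) : qform 1%:M x = \sum_i x i 0 ^+ 2.
Proof.
rewrite /qform mulmx1 mxE; apply: eq_bigr => i _.
by rewrite mxE expr2.
Qed.

Lemma qform1_ge0 n (x : 'cV[R]_n) : 0 <= qform 1%:M x.
Proof. by rewrite qform1 sumr_ge0// => i _; exact: sqr_ge0. Qed.

Lemma qform1_gt0 n (x : 'cV[R]_n) : x != 0 -> 0 < qform 1%:M x.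
Proof.
move=> x0; rewrite lt_def qform1_ge0 andbT; apply: contra x0 => /eqP.
rewrite qform1 => /psumr_eq0P h; apply/eqP/matrixP => i j.
rewrite ord1 mxE; apply/eqP; rewrite -sqrf_eq0; apply/eqP/h => // k _.
exact: sqr_ge0.
Qed.

Lemma ler_mx_norm_entry m n (X : 'M[R]_(m, n)) i j : `|X i j| <= `|X|.
Proof.
rewrite [leRHS]/Num.norm/= mx_normrE.
exact: (le_bigmax 0 (fun ij : 'I_m * 'I_n => `|X ij.1 ij.2|) (i, j)).
Qed.

Lemma mx_norm_le m n (X : 'M[R]_(m, n)) (e : R) :
  0 <= e -> (forall i j, `|X i j| <= e) -> `|X| <= e.
Proof.
move=> e0 he; rewrite [leLHS]/Num.norm/= mx_normrE.
by apply: bigmax_le => // -[i j] _ /=.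
Qed.

Lemma norm_mulmx m n p (X : 'M[R]_(m, n)) (Y : 'M[R]_(n, p)) :
  `|X *m Y| <= n%:R * `|X| * `|Y|.
Proof.
apply: mx_norm_le => [|i j]; first by rewrite !mulr_ge0.
rewrite mxE; apply: le_trans (ler_norm_sum _ _ _) _.
rewrite -mulrA [n%:R * _]mulr_natl -[X in _ *+ X](card_ord n) -sumr_const.
apply: ler_sum => k _; rewrite normrM.
by apply: ler_pM => //; exact: ler_mx_norm_entry.
Qed.

Lemma norm_trmx m n (X : 'M[R]_(m, n)) : `|X^T| = `|X|.
Proof.
apply/eqP; rewrite eq_le; apply/andP; split; apply: mx_norm_le => // i j.
  by rewrite mxE ler_mx_norm_entry.
by have := ler_mx_norm_entry X^T j i; rewrite mxE.
Qed.

(** Bound [|x_i X_ij x_j|] by [|X| (x_i^2 + x_j^2) / 2] and sum over [i], [j]. The factor [n] comes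
    from the norm being the largest absolute entry. *)
Lemma qform_norm n (X : 'M[R]_n) x :
  `|qform X x| <= n%:R * `|X| * qform 1%:M x.
Proof.
rewrite qformE.
apply: (@le_trans _ _ (\sum_(i < n) \sum_(j < n)
   (`|X| / 2 * (x i 0 ^+ 2) + `|X| / 2 * (x j 0 ^+ 2)))).
  apply: le_trans (ler_norm_sum _ _ _) _; apply: ler_sum => i _.
  apply: le_trans (ler_norm_sum _ _ _) _; apply: ler_sum => j _.
  rewrite !normrM mulrAC mulrC.
  apply: le_trans (ler_wpM2r _ (ler_mx_norm_entry X i j)) _; first by rewrite mulr_ge0.
  rewrite -mulrDr -mulrA ler_wpM2l//.
  rewrite -(real_normK (num_real (x i 0))) -(real_normK (num_real (x j 0))).
  have := sqr_ge0 (`|x i 0| - `|x j 0|).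
  by set a := `|x i 0|; set b := `|x j 0|; lra.
under eq_bigr do rewrite big_split/= sumr_const card_ord -mulr_sumr -qform1.
rewrite big_split/= sumr_const card_ord sumrMnl -mulr_sumr -qform1 -mulrnDl.
by rewrite -mulrDl -splitr -mulrA mulr_natl.
Qed.

Lemma coercmx_perturb n (c e : R) (X Y : 'M[R]_n) :
  coercmx c X -> n%:R * `|Y - X| <= e -> coercmx (c - e) Y.
Proof.
move=> cX YX x; have -> : qform Y x = qform X x + qform (Y - X) x.
  by rewrite -qformD addrC subrK.
rewrite mulrBl lerD//.
have := qform_norm (Y - X) x; rewrite ler_norml => /andP[+ _].
apply: le_trans; rewrite lerN2.
by rewrite ler_wpM2r// qform1_ge0.
Qed.

Lemma coercmx_le n (c d : R) (X : 'M[R]_n) : d <= c -> coercmx c X -> coercmx d X.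
Proof.
by move=> dc cX x; apply: le_trans (cX x); rewrite ler_wpM2r// qform1_ge0.
Qed.

Lemma coercmx_posdef n (c : R) (X : 'M[R]_n) :
  0 < c -> symmx X -> coercmx c X -> posdefmx X.
Proof.
move=> c0 sX cX; split=> // x x0; apply: lt_le_trans (cX x).
by rewrite mulr_gt0// qform1_gt0.
Qed.

Lemma symmx_block m n (X : 'M[R]_(m + n)) : symmx X ->
  [/\ symmx (ulsubmx X), symmx (drsubmx X) & dlsubmx X = (ursubmx X)^T].
Proof.
move=> sX; split; rewrite /symmx.
- by rewrite trmx_ulsub sX.
- by rewrite trmx_drsub sX.
- by rewrite trmx_ursub sX.
Qed.

(** Induction on [n] by Schur complements. For [X] with blocks [a], [b], [b^T], [D], the matrix
    [D - a^-1 b^T b] is again positive definite; its factor [M] is completed by the row made of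
    [sqrt a] and [b / sqrt a]. *)
Lemma posdef_cholesky n (X : 'M[R]_n) :
  posdefmx X -> exists M : 'M[R]_n, X = M^T *m M.
Proof.
elim: n X => [|n IH] X; first by exists 0; rewrite [X]flatmx0 mulmx0.
rewrite -[n.+1]/(1 + n)%N in X *.
move=> [sX pX].
have [sa sD eb] := symmx_block sX.
pose a := ulsubmx X 0 0; pose b : 'rV[R]_n := ursubmx X; pose D := drsubmx X.
have aE : ulsubmx X = a%:M by rewrite {1}[ulsubmx X]mx11_scalar.
have XE : X = block_mx a%:M b b^T D by rewrite -eb -aE submxK.
have qX (s : R) (z : 'cV[R]_n) :
    ((col_mx s%:M z)^T *m X *m col_mx s%:M z) 0 0 =
    a * s ^+ 2 + 2 * s * (b *m z) 0 0 + qform D z.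
  rewrite XE tr_col_mx mul_row_block mul_row_col !mulmxDl /qform.
  rewrite tr_scalar_mx !mul_mx_scalar !mul_scalar_mx -trmx_mul -scalemxAl.
  rewrite !mxE /= !mulr1n; ring.
have a0 : 0 < a.
  have := pX (col_mx 1%:M 0); rewrite qX mulmx0 /qform mulmx0 !mxE /= mulr0 !addr0.
  rewrite expr1n mulr1; apply.
  apply/eqP => /(congr1 usubmx); rewrite col_mxKu => /matrixP /(_ 0 0).
  by rewrite !mxE /=; apply/eqP; rewrite mulr1n oner_eq0.
have pS : posdefmx (D - a^-1 *: (b^T *m b)).
  split; first by rewrite /symmx linearB linearZ /= trmx_mul trmxK sD.
  move=> z z0.
  (* This first coordinate minimizes the form for fixed [z]; the minimum is the value of the Schur
     complement at [z]. *)
  have := pX (col_mx (- (a^-1 * (b *m z) 0 0))%:M z); rewrite qX.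
  have bz : (z^T *m (b^T *m b) *m z) 0 0 = (b *m z) 0 0 ^+ 2.
    rewrite mulmxA -trmx_mul -mulmxA [b *m z]mx11_scalar tr_scalar_mx -scalar_mxM.
    by rewrite [in LHS]mxE /= mulr1n !mxE /= mulr1n expr2.
  have -> : (z^T *m (D - a^-1 *: (b^T *m b)) *m z) 0 0 =
     qform D z - a^-1 * (b *m z) 0 0 ^+ 2.
    by rewrite -bz -[LHS]/(qform _ z) qformB qformZ.
  move=> h.
  suff -> : qform D z - a^-1 * (b *m z) 0 0 ^+ 2 = a * (- (a^-1 * (b *m z) 0 0)) ^+ 2 +
      2 * - (a^-1 * (b *m z) 0 0) * (b *m z) 0 0 + qform D z.
    apply: h; apply: contra z0 => /eqP /(congr1 dsubmx).
    by rewrite col_mxKd => ->; apply/eqP/matrixP => i j; rewrite !mxE.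
  by field; rewrite gt_eqF.
have [M ME] := IH _ pS.
pose r := Num.sqrt a.
have r2 : r * r = a by rewrite -expr2 sqr_sqrtr// ltW.
have r0 : r != 0 by rewrite gt_eqF// sqrtr_gt0.
exists (block_mx r%:M (r^-1 *: b) 0 M).
rewrite tr_block_mx mulmx_block !trmx0 !(mulmx0, mul0mx) !addr0.
rewrite XE !tr_scalar_mx -scalar_mxM r2 -ME mul_scalar_mx !linearZ /= mul_mx_scalar.
rewrite -!scalemxAl !scalerA mulfV// !scale1r -invfM r2.
by rewrite mulVf// scale1r scalerN addrC subrK.
Qed.

(** No compactness of the sphere is used: with [X = M^T M] and [N] the inverse of [M],
    [|x|^2 = |N (M x)|^2] is at most a constant times [|M x|^2], which is the value of the form at
    [x]. The factor [M] is invertible because a kernel vector of its transpose would annihilate the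
    form of [X]. *)
Lemma posdef_coercive n (X : 'M[R]_n) :
  posdefmx X -> exists2 c : R, 0 < c & coercmx c X.
Proof.
move=> pX; have [M ME] := posdef_cholesky pX.
have uM : M \in unitmx.
  rewrite -unitmx_tr -row_free_unit; apply: inj_row_free => v vM.
  apply/eqP/negPn/negP => v0; have := pX.2 v^T.
  rewrite ME trmxK mulmxA vM !mul0mx mxE ltxx => h.
  by apply: notF; apply: h; rewrite -trmx0 (inj_eq trmx_inj).
(* The summand 1 keeps [e] positive even when [n = 0]. *)
pose N := invmx M; pose e := n%:R * `|N^T *m N| + 1.
have e0 : 0 < e by rewrite ltr_wpDl// mulr_ge0.
exists e^-1; first by rewrite invr_gt0.
move=> x; rewrite ler_pdivrMl//.
have -> : qform 1%:M x = qform (N^T *m N) (M *m x).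
  by rewrite -[N^T]mulmx1 qform_conj mulmxA mulVmx// mul1mx.
have -> : qform X x = qform 1%:M (M *m x) by rewrite -qform_conj mulmx1 -ME.
apply: le_trans (ler_norm _) _; apply: le_trans (qform_norm _ _) _.
by rewrite ler_wpM2r ?qform1_ge0// lerDl.
Qed.

End QuadraticForms.

(** * SOS matrices and Bernstein expansions on the unit interval *)

Section SumsOfSquares.
Variable R : realType.

Lemma sosmx_sym n (X : 'M[{poly R}]_n) : sosmx X -> symmx X.
Proof. by move=> [m [Y ->]]; rewrite /symmx trmx_mul trmxK. Qed.

Lemma sosmx0 n : sosmx (0 : 'M[{poly R}]_n).
Proof. by exists 0, 0; rewrite mulmx0. Qed.

Lemma sosmxD n (X Y : 'M[{poly R}]_n) : sosmx X -> sosmx Y -> sosmx (X + Y).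
Proof.
move=> [m [U ->]] [p [V ->]]; exists (m + p)%N, (col_mx U V).
by rewrite tr_col_mx mul_row_col.
Qed.

Lemma sosmx_sum (I : Type) (r : seq I) (Q : pred I) n (F : I -> 'M[{poly R}]_n) :
  (forall i, Q i -> sosmx (F i)) -> sosmx (\sum_(i <- r | Q i) F i).
Proof.
by move=> h; apply: big_ind => //; [exact: sosmx0|exact: sosmxD].
Qed.

Lemma sosmx_sqr n p (X : 'M[{poly R}]_n) : sosmx X -> sosmx (p ^+ 2 *: X).
Proof.
move=> [m [U ->]]; exists m, (p *: U).
by rewrite [(p *: U)^T]linearZ /= -scalemxAl -scalemxAr scalerA expr2.
Qed.

Lemma sosmxZ n (c : R) (X : 'M[{poly R}]_n) :
  0 <= c -> sosmx X -> sosmx (c%:P *: X).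
Proof.
by move=> c0 sX; rewrite -(sqr_sqrtr c0) polyC_exp; exact: sosmx_sqr.
Qed.

Lemma sosmx_const n (X : 'M[R]_n) : posdefmx X -> sosmx (constpmx X).
Proof.
move=> /posdef_cholesky [M ->]; exists n, (constpmx M).
by rewrite /constpmx map_mxM map_trmx.
Qed.

Lemma sosmx_comp n (q : {poly R}) (X : 'M[{poly R}]_n) :
  sosmx X -> sosmx (map_mx (comp_poly q) X).
Proof.
move=> [m [U ->]]; exists m, (map_mx (comp_poly q) U).
by rewrite map_mxM map_trmx.
Qed.

(** Expand [X^j ((1 - X) + X)^(m - j)] by the binomial formula and shift the index by [j]. *)
Lemma bernstein_monomial (j m : nat) : (j <= m)%N ->
  'X^j = \sum_(k < m.+1) (if (j <= k)%N then 'C(m - j, k - j) else 0)%:R *: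
           ('X^k * (1 - 'X) ^+ (m - k)) :> {poly R}.
Proof.
move=> jm.
have -> : 'X^j = 'X^j * ((1 - 'X) + 'X) ^+ (m - j) :> {poly R}.
  by rewrite subrK expr1n mulr1.
rewrite exprDn mulr_sumr.
rewrite -(big_mkord xpredT (fun k => (if (j <= k)%N then 'C(m - j, k - j) else 0)%:R *:
           ('X^k * (1 - 'X) ^+ (m - k)))).
rewrite -(big_mkord xpredT (fun i => 'X^j * ((1 - 'X) ^+ (m - j - i) * 'X^i *+ 'C(m - j, i)))).
rewrite [RHS](@big_cat_nat _ _ _ j)//=; last exact: leqW.
rewrite [X in _ = X + _]big1_seq ?add0r => [|i]; last first.
  by rewrite mem_index_iota /= ltnNge => /negbTE ->; rewrite scale0r.
rewrite -[X in _ = \sum_(X <= _ < _) _]add0n big_addn subSn//.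
apply: eq_bigr => i _; rewrite leq_addl addnK.
rewrite -mulrnAr mulrCA -[_ *+ 'C(_, _)]mulr_natl.
rewrite scaler_nat -[RHS]mulr_natl exprD -subnDA [(j + i)%N]addnC; ring.
Qed.

(* The weight [ 'C(m - j, k - j) / 'C(m, k) ] of the [j]-th coefficient in the
   [k]-th Bernstein coefficient; the factor with [i = k] makes it vanish when
   [k < j]. *)
Definition bernstein_ratio (m k j : nat) : R :=
  \prod_(i < j) ((k - i)%:R / (m - i)%:R).

Lemma bernstein_ratioS m k j :
  bernstein_ratio m k j.+1 = bernstein_ratio m k j * ((k - j)%:R / (m - j)%:R).
Proof. exact: big_ord_recr. Qed.

(** Induction on [j] from [(k - j) C(m - j, k - j) = (m - j) C(m - j - 1, k - j - 1)]. At [j = k]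
    the new factor is 0, as is the coefficient it must match. *)
Lemma bin_ratio (m k j : nat) : (j <= m)%N -> (k <= m)%N ->
  (if (j <= k)%N then 'C(m - j, k - j) else 0)%:R
  = 'C(m, k)%:R * bernstein_ratio m k j.
Proof.
move=> jm km; elim: j jm => [|j IH] jm.
  by rewrite /bernstein_ratio big_ord0 mulr1 !subn0.
rewrite bernstein_ratioS mulrA -IH; last exact: ltnW.
have mj : (m - j)%:R != 0 :> R by rewrite pnatr_eq0; lia.
apply: (mulIf mj); rewrite -[in RHS]mulrA divfK//.
have [jk|jk|->] := ltngtP j k.
- rewrite -!natrM; congr (_%:R).
  rewrite mulnC [RHS]mulnC.
  have -> : (k - j = (k - j.+1).+1)%N by lia.
  have -> : (m - j.+1 = (m - j).-1)%N by lia.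
  by rewrite mul_bin_diag; lia.
- by rewrite !mul0r.
- by rewrite subnn mul0r mulr0.
Qed.

(** For [i <= k] the difference is exactly [i (m - k) / (m (m - i))] in absolute value. For [k < i]
    the truncated [k - i] is 0 and only [k / m], with [k < p], is left to bound. *)
Lemma bernstein_factor_close (m k i p : nat) : (i <= p)%N -> (p < m)%N -> (k <= m)%N ->
  `|(k - i)%:R / (m - i)%:R - k%:R / m%:R| <= p%:R / (m - p)%:R :> R.
Proof.
move=> ip pm km.
have m0 : 0 < m%:R :> R by rewrite ltr0n; lia.
have mp0 : 0 < (m - p)%:R :> R by rewrite ltr0n; lia.
have mi0 : 0 < (m - i)%:R :> R by rewrite ltr0n; lia.
have key (u v : nat) : (u * (m - p) <= p * v)%N -> (0 < v)%N ->
    u%:R / v%:R <= p%:R / (m - p)%:R :> R.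
  by move=> h v0; rewrite ler_pdivrMr ?ltr0n// mulrAC ler_pdivlMr// -!natrM ler_nat.
have [ik|ki] := leqP i k; last first.
  have -> : (k - i = 0)%N by lia.
  rewrite mul0r sub0r normrN ger0_norm ?divr_ge0//; apply: key; last by lia.
  by apply: leq_mul; lia.
rewrite distrC ger0_norm.
  have -> : k%:R / m%:R - (k - i)%:R / (m - i)%:R =
     (i * (m - k))%:R / (m * (m - i))%:R :> R.
    rewrite !natrM !natrB; try lia.
    have mi : m%:R - i%:R != 0 :> R by rewrite -natrB ?gt_eqF//; lia.
    by field; rewrite mi (gt_eqF m0).
  apply: key; last by rewrite muln_gt0; lia.
  rewrite -mulnA; apply: leq_mul => //; apply: leq_mul; lia.
rewrite subr_ge0 ler_pdivrMr// mulrAC ler_pdivlMr// -!natrM ler_nat; nia.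
Qed.

Lemma ratio_01 (k m : nat) : (k <= m)%N -> 0 <= (k%:R / m%:R : R) <= 1.
Proof.
move=> km; rewrite divr_ge0//=.
case: m km => [|m] km; first by rewrite invr0 mulr0.
by rewrite ler_pdivrMr ?ltr0n// mul1r ler_nat.
Qed.

(** Both products have factors in [[0, 1]], so the errors of the [j] factors simply add up. Hence
    the Bernstein coefficients of a fixed polynomial approach its values at [k / m], uniformly in
    [k]. *)
Lemma bernstein_ratio_close (m k j p : nat) : (j <= p)%N -> (p < m)%N -> (k <= m)%N ->
  `|bernstein_ratio m k j - (k%:R / m%:R) ^+ j| <= j%:R * (p%:R / (m - p)%:R).
Proof.
move=> jp pm km; elim: j jp => [|j IH] jp.
  by rewrite /bernstein_ratio big_ord0 expr0 subrr normr0 mul0r.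
rewrite bernstein_ratioS exprSr.
have {IH} := IH (ltnW jp).
have := @bernstein_factor_close m k j p (ltnW jp) pm km.
set a := bernstein_ratio m k j; set b := (k - j)%:R / (m - j)%:R.
set d := k%:R / m%:R; set e := p%:R / (m - p)%:R => hbd hac.
have -> : a * b - d ^+ j * d = (a - d ^+ j) * b + d ^+ j * (b - d) by ring.
have /andP[d0 d1] : 0 <= d <= 1 by exact: ratio_01.
have /andP[b0 b1] : 0 <= b <= 1 by apply: ratio_01; rewrite leq_sub2r.
have nb : `|b| <= 1 by rewrite ger0_norm.
have nd : `|d ^+ j| <= 1 by rewrite normrX ger0_norm// exprn_ile1.
apply: le_trans (ler_normD _ _) _; rewrite (normrM _ b) (normrM _ (b - d)).
rewrite -[j.+1]addn1 natrD mulrDl mul1r; apply: lerD.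
  by rewrite -[leRHS]mulr1 ler_pM.
by rewrite -[leRHS]mul1r ler_pM.
Qed.

Lemma evalpmx_sum_coef n (F : 'M[{poly R}]_n) p t :
  (forall i j, (size (F i j) <= p)%N) ->
  evalpmx F t = \sum_(l < p) t ^+ l *: map_mx (fun q : {poly R} => q`_l) F.
Proof.
move=> hp; apply/matrixP => i j; rewrite summxE mxE (horner_coef_wide _ (hp i j)).
by apply: eq_bigr => l _; rewrite !mxE mulrC.
Qed.

Lemma pmx_sum_bernstein n (F : 'M[{poly R}]_n) p m :
  (forall i j, (size (F i j) <= p)%N) -> (p <= m)%N ->
  F = \sum_(k < m.+1) ('C(m, k)%:R *: ('X^k * (1 - 'X) ^+ (m - k))) *:
        constpmx (\sum_(l < p) bernstein_ratio m k l *: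
          map_mx (fun q : {poly R} => q`_l) F).
Proof.
move=> hp pm; apply/matrixP => i j; rewrite summxE -[LHS]coefK poly_def.
rewrite (big_ord_widen p (fun l => (F i j)`_l *: 'X^l))// big_mkcond /=.
transitivity (\sum_(l < p) \sum_(k < m.+1)
    (F i j)`_l *: (('C(m, k)%:R * bernstein_ratio m k l) *: ('X^k * (1 - 'X) ^+ (m - k)))).
  apply: eq_bigr => l _.
  case: ltnP => [_|szl]; last first.
    by rewrite big1// => k _; rewrite nth_default// scale0r.
  have lm : (l <= m)%N by apply: leq_trans pm; exact: ltnW.
  rewrite (bernstein_monomial lm).
  rewrite scaler_sumr; apply: eq_bigr => k _.
  by congr (_ *: _); rewrite bin_ratio// -ltnS.
rewrite exchange_big /=; apply: eq_bigr => k _.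
rewrite !mxE summxE rmorph_sum /= mulr_sumr; apply: eq_bigr => l _.
rewrite !mxE [RHS]mulrC mul_polyC !scalerA; congr (_ *: _); ring.
Qed.

(** The [k]-th Bernstein coefficient [D k] is close to [F (k / m)], which is at least [c I]; once
    the error is at most [c / 2], each [D k] is positive definite. The terms are then sorted by the
    parity of [k]. *)
Lemma sosmx_unit_interval n (F : 'M[{poly R}]_n) (c : R) :
  0 < c -> symmx F ->
  (forall t, 0 <= t <= 1 -> coercmx c (evalpmx F t)) ->
  exists S0 S1, [/\ sosmx S0, sosmx S1 & F = S0 + ('X * (1 - 'X)) *: S1].
Proof.
move=> c0 sF cF.
pose p := (\max_i \max_j size (F i j))%N.
have hp i j : (size (F i j) <= p)%N.
  apply: leq_trans (leq_bigmax i); exact: (leq_bigmax (F := fun j => size (F i j)) j).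
pose G l := map_mx (fun q : {poly R} => q`_l) F.
pose K : R := \sum_(l < p) `|G l|.
pose e := n%:R * (p%:R * p%:R * K) / (c / 2).
have e0 : 0 <= e by rewrite divr_ge0 ?mulr_ge0 ?sumr_ge0// ltW// divr_gt0.
(* Doubling makes [m] even, and [m - p >= q > e] brings the approximation error, of order
   [1 / (m - p)], below [c / 2]. *)
pose q := (Num.bound e).+1; pose m := (p + q).*2.
have mp : e <= (m - p)%:R.
  apply: (@le_trans _ _ q%:R); last by rewrite ler_nat /m; lia.
  apply: ltW; apply: lt_trans (archi_boundP e0) _.
  by rewrite ltr_nat.
have pm : (p < m)%N by rewrite /m /q; lia.
pose D k := \sum_(l < p) bernstein_ratio m k l *: G l.
have pD (k : nat) : (k <= m)%N -> posdefmx (D k).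
  move=> km; apply: (@coercmx_posdef _ _ (c / 2)); first by rewrite divr_gt0.
    rewrite /symmx /D linear_sum /=; apply: eq_bigr => l _; rewrite linearZ /=.
    by congr (_ *: _); rewrite /G map_trmx sF.
  have -> : c / 2 = c - c / 2 by lra.
  apply: (@coercmx_perturb _ _ _ _ (evalpmx F (k%:R / m%:R))).
    by apply: cF; exact: ratio_01.
  rewrite (evalpmx_sum_coef _ hp) -sumrB.
  apply: (@le_trans _ _ (n%:R * \sum_(l < p) (p%:R * (p%:R / (m - p)%:R)) * `|G l|)).
    rewrite ler_wpM2l//; apply: le_trans (ler_norm_sum _ _ _) _.
    apply: ler_sum => l _; rewrite -scalerBl mx_normZ ler_wpM2r//.
    apply: le_trans (bernstein_ratio_close _ pm km) _; first exact: ltnW.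
    by rewrite ler_wpM2r ?divr_ge0// ler_nat ltnW.
  rewrite -mulr_sumr -/K.
  have mp0 : 0 < (m - p)%:R :> R by rewrite ltr0n; lia.
  rewrite (_ : n%:R * _ = n%:R * (p%:R * p%:R * K) / (m - p)%:R); last by ring.
  by rewrite ler_pdivrMr// [leRHS]mulrC -ler_pdivrMr// divr_gt0.
(* Halves are rounded down: the square is the full Bernstein monomial for even [k], and misses
   exactly one factor [X (1 - X)] for odd [k], since [m - k] then is odd too. *)
pose B (k : nat) : 'M[{poly R}]_n :=
  (('X^(k./2) * (1 - 'X) ^+ ((m - k)./2)) ^+ 2) *:
    (('C(m, k)%:R)%:P *: constpmx (D k)).
have sB k : (k <= m)%N -> sosmx (B k).
  by move=> km; apply/sosmx_sqr/sosmxZ => //; exact/sosmx_const/pD.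
exists (\sum_(k < m.+1 | ~~ odd k) B k), (\sum_(k < m.+1 | odd k) B k); split.
- by apply: sosmx_sum => k _; apply: sB; rewrite -ltnS.
- by apply: sosmx_sum => k _; apply: sB; rewrite -ltnS.
rewrite {1}(pmx_sum_bernstein hp (ltnW pm)) (bigID (fun k : 'I_m.+1 => odd k)) /=.
rewrite addrC scaler_sumr.
have mE : ~~ odd m by rewrite /m odd_double.
congr (_ + _); apply: eq_bigr => k ok; rewrite /B !scalerA; congr (_ *: _);
  rewrite exprMn -!exprM -mul_polyC [LHS]mulrC.
  congr (_ * _); congr (_ ^+ _ * _ ^+ _); have := ltn_ord k; lia.
congr (_ * _).
rewrite mulrACA -!exprS; congr (_ ^+ _ * _ ^+ _); have := ltn_ord k; lia.
Qed.

End SumsOfSquares.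

(** * Certificates of positivity on a compact interval *)

Section IntervalPositivstellensatz.
Variable R : realType.

(** Affine change of variable: [q] maps [[0, 1]] onto [[a, b]] and [r] is its inverse. Composing
    [X (1 - X)] with [r] gives [(X - a)(b - X) / w^2], so the multiplier carries the factor
    [w^-2]. *)
Lemma sosmx_nondegenerate_interval n (F : 'M[{poly R}]_n) (a b c : R) :
  0 < c -> a < b -> symmx F ->
  (forall t, a <= t <= b -> coercmx c (evalpmx F t)) ->
  exists2 G, sosmx G & sosmx (F - (('X - a%:P) * (b%:P - 'X)) *: G).
Proof.
move=> c0 ab sF cF.
pose w := b - a; have w0 : w != 0 by rewrite subr_eq0 gt_eqF.
pose q : {poly R} := w *: 'X + a%:P.
pose r : {poly R} := w^-1 *: ('X - a%:P).
have qr : q \Po r = 'X.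
  rewrite /q comp_polyD comp_polyZ comp_polyX comp_polyC /r scalerA mulfV//.
  by rewrite scale1r subrK.
have [||t /andP[t0 t1]|S0 [S1 [s0 s1 FE]]] :=
    @sosmx_unit_interval _ _ (map_mx (comp_poly q) F) c.
- by [].
- by rewrite /symmx map_trmx sF.
- have -> : evalpmx (map_mx (comp_poly q) F) t = evalpmx F (w * t + a).
    by apply/matrixP => i j; rewrite !mxE horner_comp !hornerE.
  apply: cF; rewrite lerDr mulr_ge0 ?subr_ge0 ?(ltW ab)//=.
  rewrite -lerBrDr -/w -[leRHS]mulr1 ler_wpM2l//.
  by rewrite subr_ge0 ltW.
exists ((w ^- 2)%:P *: map_mx (comp_poly r) S1).
  by apply: sosmxZ; [rewrite invr_ge0 sqr_ge0|exact: sosmx_comp].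
have -> : F = map_mx (comp_poly r) (map_mx (comp_poly q) F).
  by apply/matrixP => i j; rewrite !mxE -comp_polyA qr comp_polyXr.
rewrite FE map_mxD scalerA.
have -> : map_mx (comp_poly r) (('X * (1 - 'X)) *: S1) =
    ((('X - a%:P) * (b%:P - 'X)) * (w ^- 2)%:P) *: map_mx (comp_poly r) S1.
  apply/matrixP => i j; rewrite !mxE comp_polyM; congr (_ * _).
  rewrite comp_polyM comp_polyB comp_polyX -polyC1 comp_polyC polyC1 /r -!mul_polyC.
  have -> : b%:P = w%:P + a%:P by rewrite -polyCD subrK.
  have ww : w%:P * (w^-1)%:P = 1 by rewrite -polyCM mulfV.
  rewrite -exprVn polyC_exp -{1}ww.
  move: (w%:P) ((w^-1)%:P) (a%:P) => w1 v a1; ring.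
by rewrite addrK; exact: sosmx_comp.
Qed.

(* On a one-point interval the multiplier is [- ('X - a)^2]: writing
   [F = F(a) + ('X - a) F1], it suffices to complete the square. *)
Lemma sosmx_point n (F : 'M[{poly R}]_n) (a c : R) :
  0 < c -> symmx F -> coercmx c (evalpmx F a) ->
  exists2 G, sosmx G & sosmx (F - (('X - a%:P) * (a%:P - 'X)) *: G).
Proof.
move=> c0 sF cF.
pose x : {poly R} := 'X - a%:P.
have [F1 FE sF1] : exists2 F1, F = constpmx (evalpmx F a) + x *: F1 & F1^T = F1.
  exists (map_mx (fun p : {poly R} => (p - p.[a]%:P) %/ x) F).
    apply/matrixP => i j; rewrite !mxE.
    have dv : x %| F i j - (F i j).[a]%:P.
      by rewrite dvdp_XsubCl /root hornerD hornerN hornerC subrr.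
    by rewrite [x * _]mulrC divpK// addrC subrK.
  by rewrite map_trmx sF.
(* Half of [c] stays in the constant term and the other half completes the square, with
   [V = I + x F1 / (2 d)] and [d V^2 = d I + x F1 + x^2 F1^2 / (4 d)]; this fixes the factor
   [1 / (4 d)] of the multiplier. *)
pose d := c / 2; have d0 : 0 < d by rewrite divr_gt0.
exists ((4 * d)^-1%:P *: (F1^T *m F1)).
  by apply: sosmxZ; [rewrite invr_ge0 mulr_ge0// ltW|exists n, F1].
pose V := 1%:M + ((2 * d)^-1%:P * x) *: F1.
have -> : F - (('X - a%:P) * (a%:P - 'X)) *: ((4 * d)^-1%:P *: (F1^T *m F1)) =
    constpmx (evalpmx F a - d%:M) + d%:P *: (V^T *m V).
  have sV : V^T = V by rewrite /V [LHS]linearD /= [(_ *: _)^T]linearZ /= sF1 trmx1.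
  rewrite {1}FE sV sF1 /V mulmxDl !mulmxDr.
  rewrite !mulmx1 mul1mx -!scalemxAl -!scalemxAr.
  have -> : constpmx (evalpmx F a - d%:M) = constpmx (evalpmx F a) - d%:P *: 1%:M.
    by rewrite /constpmx map_mxB map_scalar_mx scalemx1.
  apply/matrixP => i j; move: (constpmx _) (F1 *m F1) => U W; rewrite !mxE -/x.
  have -> : a%:P - 'X = - x by rewrite /x opprB.
  have d1 : d%:P * (2 * d)^-1%:P = 2^-1%:P.
    by rewrite -polyCM; congr (_%:P); field; rewrite gt_eqF.
  have d2 : (4 * d)^-1%:P = d%:P * (2 * d)^-1%:P * (2 * d)^-1%:P.
    by rewrite -!polyCM; congr (_%:P); field; rewrite gt_eqF.
  have h2 : 1 = 2 * 2^-1%:P :> {poly R}.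
    by rewrite -polyC1 -polyC_natr -polyCM mulfV// pnatr_eq0.
  rewrite d2 d1; move: d1; set e := (2 * d)^-1%:P => d1.
  have -> : x * F1 i j = 2 * 2^-1%:P * (x * F1 i j) by rewrite -h2 mul1r.
  by rewrite -d1; move: (i == j)%:R (d%:P) => u v; ring.
apply: sosmxD.
  apply: sosmx_const; apply: (@coercmx_posdef _ _ (c - d)).
  - by rewrite /d; lra.
  - by rewrite /symmx linearB /= tr_scalar_mx /evalpmx map_trmx sF.
  - move=> y; rewrite mulrBl qformB lerB//; last first.
    by rewrite -scalemx1 qformZ.
by apply: sosmxZ; [exact: ltW|exists n, V].
Qed.

Lemma sosmx_interval n (F : 'M[{poly R}]_n) (a b c : R) :
  0 < c -> a <= b -> symmx F ->
  (forall t, a <= t <= b -> coercmx c (evalpmx F t)) ->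
  exists2 G, sosmx G & sosmx (F - (('X - a%:P) * (b%:P - 'X)) *: G).
Proof.
move=> c0; rewrite le_eqVlt => /predU1P[<- sF cF|ab sF cF].
  by apply: (sosmx_point c0 sF); apply: cF; rewrite lexx.
exact: sosmx_nondegenerate_interval ab sF cF.
Qed.

End IntervalPositivstellensatz.

(** * The matrix exponential and its Taylor truncations *)

Definition exppmx (R : realType) (n : nat) (A : 'M[R]_n) (m : nat) :
    'M[{poly R}]_n :=
  \sum_(k < m) ((k`!%:R)^-1 *: 'X^k) *: constpmx (A ^+ k).

Section MatrixExponential.
Local Open Scope classical_set_scope.
Variable R : realType.

(** Weierstrass test: the Cauchy criterion passes from the majorant to [u]. The tail bound is the
    limit in [q] of the bound on the partial sums from [p] to [q]. *)
Lemma series_mx_majorized m n (u : nat -> 'M[R]_(m, n)) (v : R^nat) :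
  (forall k, `|u k| <= v k) -> cvgn (series v) ->
  cvgn (series u) /\
  forall p, `|limn (series u) - series u p| <= limn (series v) - series v p.
Proof.
move=> uv cv.
have sub p q : (p <= q)%N -> `|series u q - series u p| <= series v q - series v p.
  move=> pq; rewrite !sub_series pq; apply: le_trans (ler_norm_sum _ _ _) _.
  exact: ler_sum.
have cu : cvgn (series u).
  apply: cauchy_cvg; apply/cauchy_seriesP => e e0.
  move/cauchy_cvgP/cauchy_seriesP : cv => /(_ e e0).
  apply: filterS => -[p q] /=; apply: le_lt_trans.
  apply: le_trans (ler_norm_sum _ _ _) _; apply: le_trans (ler_norm _).
  exact: ler_sum.
split=> // p; apply: (@ler_cvg_to _ \oo _ _ (fun q => `|series u q - series u p|)
  (fun q => series v q - series v p)).
- by apply: cvg_norm; apply: cvgB => //; exact: cvg_cst.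
- by apply: cvgB => //; exact: cvg_cst.
- by exists p => // q /= pq; exact: sub.
Qed.

Lemma norm_mx1 n : `|1%:M : 'M[R]_n| <= 1.
Proof.
apply: mx_norm_le => // i j; rewrite mxE.
by case: (i == j); rewrite ?normr1 ?normr0.
Qed.

Lemma norm_exprmx n (A : 'M[R]_n) k : `|A ^+ k| <= (n%:R * `|A|) ^+ k.
Proof.
elim: k => [|k IH]; first by rewrite !expr0; exact: norm_mx1.
rewrite exprS (exprS (n%:R * _)); apply: le_trans (norm_mulmx _ _) _.
by rewrite ler_wpM2l// mulr_ge0.
Qed.

Lemma norm_exp_term n (A : 'M[R]_n) (b : R) k :
  n%:R * `|A| <= b -> `|(k`!%:R)^-1 *: A ^+ k| <= exp_coeff b k.
Proof.
move=> Ab; rewrite normrZ ger0_norm ?invr_ge0// mulrC /exp_coeff /=.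
rewrite ler_wpM2r ?invr_ge0//; apply: le_trans (norm_exprmx _ _) _.
by rewrite lerXn2r// nnegrE ?(le_trans _ Ab) ?mulr_ge0.
Qed.

Definition exp_tail (b : R) (m : nat) : R := expR b - series (exp_coeff b) m.

Lemma expmx_cvg n (A : 'M[R]_n) :
  series (fun k => (k`!%:R)^-1 *: A ^+ k) @ \oo --> expmx A.
Proof.
exact: (series_mx_majorized (fun k => norm_exp_term k (lexx _))
  (is_cvg_series_exp_coeff _)).1.
Qed.

Lemma expmx_close n (A : 'M[R]_n) (b : R) m : n%:R * `|A| <= b ->
  `|expmx A - series (fun k => (k`!%:R)^-1 *: A ^+ k) m| <= exp_tail b m.
Proof.
move=> Ab; exact: (series_mx_majorized (fun k => norm_exp_term k Ab)
  (is_cvg_series_exp_coeff _)).2.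
Qed.

Lemma exp_tail_cvg (b : R) : exp_tail b @ \oo --> 0.
Proof.
rewrite -(subrr (expR b)); apply: cvgB; first exact: cvg_cst.
exact: is_cvg_series_exp_coeff.
Qed.

Lemma exp_tail_ge0 (b : R) m : 0 <= b -> 0 <= exp_tail b m.
Proof.
move=> b0; rewrite subr_ge0; apply: nondecreasing_cvgn_le.
  by apply: nondecreasing_series => k _ _; exact: exp_coeff_ge0.
exact: is_cvg_series_exp_coeff.
Qed.

Lemma exprmx_tr n (A : 'M[R]_n) k : (A ^+ k)^T = A^T ^+ k.
Proof.
elim: k => [|k IH]; first by rewrite !expr0 trmx1.
by rewrite exprS exprSr -IH; exact: trmx_mul.
Qed.

(** Transposition preserves the norm, so the transposed partial sums, which are those of [A^T],
    converge to the transposed limit. *)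
Lemma expmx_tr n (A : 'M[R]_n) : expmx A^T = (expmx A)^T.
Proof.
apply: (cvg_lim (@norm_hausdorff R ('M[R]_n : normedModType R))).
apply/cvgrPdist_lt => e e0; move/cvgrPdist_lt : (@expmx_cvg n A) => /(_ e e0).
apply: filterS => m; rewrite -norm_trmx; congr (`|_| < _).
rewrite linearB /=; congr (_ - _); rewrite /series /= linear_sum /=.
by apply: eq_bigr => k _; rewrite linearZ /= exprmx_tr.
Qed.

Lemma exprmxZ n (A : 'M[R]_n) t k : (t *: A) ^+ k = t ^+ k *: A ^+ k.
Proof.
elim: k => [|k IH]; first by rewrite !expr0 scale1r.
rewrite !exprS IH -[LHS]/((t *: A) *m (t ^+ k *: A ^+ k)).
by rewrite -scalemxAl -scalemxAr scalerA.
Qed.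

Lemma evalpmx_sum n m (F : 'I_m -> 'M[{poly R}]_n) t :
  evalpmx (\sum_k F k) t = \sum_k evalpmx (F k) t.
Proof.
apply/matrixP => i j; rewrite mxE !summxE horner_sum.
by apply: eq_bigr => k _; rewrite mxE.
Qed.

Lemma evalpmx_exppmx n (A : 'M[R]_n) m t :
  evalpmx (exppmx A m) t = \sum_(k < m) (t ^+ k / k`!%:R) *: A ^+ k.
Proof.
rewrite evalpmx_sum; apply: eq_bigr => k _.
by apply/matrixP => i j; rewrite !mxE hornerM hornerZ hornerXn hornerC [_ / _]mulrC.
Qed.

Lemma evalpmx_exppmx_series n (A : 'M[R]_n) m t :
  evalpmx (exppmx A m) t = series (fun k => (k`!%:R)^-1 *: (t *: A) ^+ k) m.
Proof.
rewrite evalpmx_exppmx /series /= big_mkord; apply: eq_bigr => k _.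
by rewrite exprmxZ scalerA mulrC.
Qed.

Lemma continuous_evalpmx_exppmx n (A : 'M[R]_n) m :
  continuous (fun t => evalpmx (exppmx A m) t).
Proof.
under eq_fun do rewrite evalpmx_exppmx.
move=> t; apply: cvg_big => [|k _]; first exact: add_continuous.
apply: cvgZr_tmp; apply: cvgM; last exact: cvg_cst.
exact: exprn_continuous.
Qed.

Section OnInterval.
Variables (n : nat) (A : 'M[R]_n) (T : R).
Let b := T * (n%:R * `|A|).

Lemma norm_scale_le t : 0 <= t <= T -> n%:R * `|t *: A| <= b.
Proof.
move=> /andP[t0 tT]; rewrite normrZ ger0_norm// mulrCA.
by rewrite ler_wpM2r// mulr_ge0.
Qed.

Lemma exppmx_close t m : 0 <= t <= T ->
  `|expmx (t *: A) - evalpmx (exppmx A m) t| <= exp_tail b m.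
Proof.
by move=> tT; rewrite evalpmx_exppmx_series; exact/expmx_close/norm_scale_le.
Qed.

Lemma norm_exppmx_le t m : 0 <= t <= T ->
  `|evalpmx (exppmx A m) t| <= expR b.
Proof.
move=> tT; rewrite evalpmx_exppmx_series.
apply: le_trans (ler_norm_sum _ _ _) _.
apply: (@le_trans _ _ (series (exp_coeff b) m)).
  by apply: ler_sum => k _; exact/norm_exp_term/norm_scale_le.
rewrite -subr_ge0; apply: exp_tail_ge0; apply: le_trans (norm_scale_le tT).
by rewrite mulr_ge0.
Qed.

Lemma norm_expmx_le t : 0 <= t <= T -> `|expmx (t *: A)| <= expR b.
Proof.
(* With no terms the truncation is 0 and [exp_tail b 0] is [expR b], so the error estimate becomes a
   bound on the exponential. *)
move=> tT; have := exppmx_close 0 tT.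
by rewrite /exp_tail /series /= big_mkord big_ord0 subr0 evalpmx_exppmx big_ord0 subr0.
Qed.

End OnInterval.

End MatrixExponential.

(** * Uniformity of the jump inequality in time and truncation order *)

Section UniformCoercivity.
Local Open Scope classical_set_scope.
Variable R : realType.

Lemma norm_mulmx3 n (X Y Z : 'M[R]_n) :
  `|X *m Y *m Z| <= n%:R ^+ 2 * `|X| * `|Y| * `|Z|.
Proof.
apply: le_trans (norm_mulmx _ _) _.
apply: (@le_trans _ _ (n%:R * (n%:R * `|X| * `|Y|) * `|Z|)).
  by rewrite ler_wpM2r// ler_wpM2l// norm_mulmx.
by rewrite expr2 !mulrA.
Qed.

(** Lipschitz estimate on the ball of radius [l], from [Y^T Q Y - X^T Q X = (Y - X)^T Q Y + X^T Q (Y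
    - X)]. *)
Lemma norm_congruence_sub n (J Q X Y : 'M[R]_n) (l : R) :
  `|X| <= l -> `|Y| <= l ->
  `|J^T *m Y^T *m Q *m Y *m J - J^T *m X^T *m Q *m X *m J|
  <= (n%:R ^+ 4 * `|J| ^+ 2 * `|Q| * (2 * l)) * `|Y - X|.
Proof.
move=> Xl Yl.
have -> : J^T *m Y^T *m Q *m Y *m J - J^T *m X^T *m Q *m X *m J =
    J^T *m ((Y - X)^T *m Q *m Y + X^T *m Q *m (Y - X)) *m J.
  by rewrite linearB /= !(mulmxBl, mulmxBr, mulmxDl, mulmxDr) !mulmxA addrA subrK.
apply: le_trans (norm_mulmx3 _ _ _) _; rewrite norm_trmx.
have h : `|(Y - X)^T *m Q *m Y + X^T *m Q *m (Y - X)| <=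
    n%:R ^+ 2 * `|Q| * (2 * l) * `|Y - X|.
  apply: le_trans (ler_normD _ _) _.
  have h1 : `|(Y - X)^T *m Q *m Y| <= n%:R ^+ 2 * `|Q| * `|Y - X| * l.
    apply: le_trans (norm_mulmx3 _ _ _) _; rewrite norm_trmx [_ * _ * `|Q|]mulrAC.
    by rewrite ler_wpM2l// !mulr_ge0 ?exprn_ge0.
  have h2 : `|X^T *m Q *m (Y - X)| <= n%:R ^+ 2 * `|Q| * `|Y - X| * l.
    apply: le_trans (norm_mulmx3 _ _ _) _; rewrite norm_trmx.
    rewrite [X in X <= _](_ : _ = n%:R ^+ 2 * `|Q| * `|Y - X| * `|X|); last first.
      by move: `|Y - X| `|X| `|Q| (n%:R ^+ 2) => x1 x2 x3 x4; ring.
    by rewrite ler_wpM2l// !mulr_ge0 ?exprn_ge0.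
  apply: le_trans (lerD h1 h2) _.
  move: `|Y - X| `|Q| (n%:R ^+ 2) => x1 x3 x4.
  by rewrite le_eqVlt; apply/orP; left; apply/eqP; ring.
apply: (@le_trans _ _ (n%:R ^+ 2 * `|J| * (n%:R ^+ 2 * `|Q| * (2 * l) * `|Y - X|) * `|J|)).
  by rewrite ler_wpM2r// ler_wpM2l// !mulr_ge0 ?exprn_ge0.
rewrite (_ : n%:R ^+ 4 = (n%:R ^+ 2) * (n%:R ^+ 2)); last by rewrite -exprD.
move: `|Y - X| `|Q| `|J| (n%:R ^+ 2) => x1 x2 x3 x4.
by rewrite le_eqVlt; apply/orP; left; apply/eqP; ring.
Qed.

(** Continuity is borrowed from a single truncation of order [m0], a polynomial in time. Three
    uniform tail errors and this continuity error, each below [e / 4], link the truncation at [t']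
    to the exponential at [t]. *)
Lemma exppmx_uniform_near n (A : 'M[R]_n) (T t e : R) :
  0 <= t <= T -> 0 < e ->
  \forall t' \near t & m \near \oo,
    0 <= t' <= T -> `|evalpmx (exppmx A m) t' - expmx (t *: A)| < e.
Proof.
move=> tT e0; pose b := T * (n%:R * `|A|).
have e4 : 0 < e / 4 by rewrite divr_gt0.
have [m0 _ hm0] : \forall m \near \oo, exp_tail b m < e / 4.
  move/cvgrPdist_lt : (@exp_tail_cvg _ b) => /(_ _ e4); apply: filterS => m.
  by rewrite sub0r normrN; apply: le_lt_trans (ler_norm _).
have := @continuous_evalpmx_exppmx _ _ A m0 t.
move=> /cvgrPdist_lt /(_ _ e4) ct.
exists ([set t' | `|evalpmx (exppmx A m0) t - evalpmx (exppmx A m0) t'| < e / 4],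
        [set m | (m0 <= m)%N]).
  by split => //=; exists m0.
move=> [t' m] /= [ht' hm] t'T.
have h1 : `|expmx (t *: A) - evalpmx (exppmx A m0) t| < e / 4.
  exact: le_lt_trans (exppmx_close A m0 tT) (hm0 _ (leqnn _)).
have h2 : `|expmx (t' *: A) - evalpmx (exppmx A m0) t'| < e / 4.
  exact: le_lt_trans (exppmx_close A m0 t'T) (hm0 _ (leqnn _)).
have h3 : `|expmx (t' *: A) - evalpmx (exppmx A m) t'| < e / 4.
  exact: le_lt_trans (exppmx_close A m t'T) (hm0 _ hm).
move: (expmx (t *: A)) (expmx (t' *: A)) ht' h1 h2 h3 => X X'.
move: (evalpmx (exppmx A m0) t) (evalpmx (exppmx A m0) t') (evalpmx (exppmx A m) t').
move=> Y0 Y0' Y' ht' h1 h2 h3.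
have -> : Y' - X = - (X' - Y') + (X' - Y0') - (Y0 - Y0') - (X - Y0).
  by apply/matrixP => i j; rewrite !mxE; ring.
apply: le_lt_trans (ler_normB _ _) _.
apply: (@lt_le_trans _ _ (e / 4 + e / 4 + e / 4 + e / 4)); last by lra.
apply: ltrD h1; apply: le_lt_trans (ler_normB _ _) _; apply: ltrD ht'.
by apply: le_lt_trans (ler_normD _ _) _; rewrite normrN ltrD.
Qed.

Lemma coercmx_uniform_exppmx n (A J P Q : 'M[R]_n) (a T : R) : 0 <= a ->
  (forall t, a <= t <= T ->
    posdefmx (P - J^T *m (expmx (t *: A))^T *m Q *m expmx (t *: A) *m J)) ->
  exists c m0, 0 < c /\ forall m t, (m0 <= m)%N -> a <= t <= T ->
    coercmx c (P - J^T *m (evalpmx (exppmx A m) t)^T *m Q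
                   *m evalpmx (exppmx A m) t *m J).
Proof.
move=> a0 pd.
pose G Y := P - J^T *m Y^T *m Q *m Y *m J.
pose l := expR (T * (n%:R * `|A|)).
pose C := n%:R * (n%:R ^+ 4 * `|J| ^+ 2 * `|Q| * (2 * l)).
have C0 : 0 <= C by rewrite !mulr_ge0 ?exprn_ge0 ?expR_ge0.
have GC X Y : `|X| <= l -> `|Y| <= l -> n%:R * `|G Y - G X| <= C * `|Y - X|.
  move=> Xl Yl.
  have e (U V : 'M[R]_n) : P - U - (P - V) = - (U - V).
    by rewrite !opprB addrC addrA subrK.
  by rewrite e normrN -mulrA ler_wpM2l// norm_congruence_sub.
have aT t : a <= t <= T -> 0 <= t <= T.
  by move=> /andP[at_ ->]; rewrite (le_trans a0 at_).
(* Compactness of [[a, T]] in its near-covering form, with the parameter [(m, c)] tending to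
   infinity and to [0] from the right: a local statement around each [t] yields one threshold for
   all of them. *)
have : \forall mc \near filter_prod \oo (0 : R)^'+, `[a, T]%classic `<=`
    (fun t => coercmx mc.2 (G (evalpmx (exppmx A mc.1) t))).
  apply: (near_covering_withinP _).2.
    exact/compact_near_coveringP/segment_compact.
  move=> t; rewrite /= in_itv /= => tT.
  have [ct ct0 cG] := posdef_coercive (pd t tT).
  have C1 : 0 < C + 1 by rewrite ltr_wpDl.
  (* Closeness at this scale costs at most [ct / 2] of coercivity; [C + 1] replaces [C], which may
     vanish. *)
  have e0 : 0 < ct / 2 / (C + 1) by rewrite !divr_gt0.
  have [[U V] /= [Ut Voo] UV] := exppmx_uniform_near A (aT _ tT) e0.
  exists (U, V `*` [set c | c < ct / 2]) => /=.
    split=> //; exists (V, [set c | c < ct / 2]) => //=; split=> //.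
    by apply: nbhs_right_lt; rewrite divr_gt0.
  move=> [t' [m c]] /= [Ut' [Vm cc]]; rewrite in_itv /= => t'T.
  have h := UV (t', m) (conj Ut' Vm) (aT _ t'T).
  apply: (@coercmx_le _ _ (ct - ct / 2)); first by lra.
  apply: (coercmx_perturb cG).
  apply: le_trans (GC _ _ _ _) _.
  - exact: norm_expmx_le (aT _ tT).
  - exact: norm_exppmx_le (aT _ t'T).
  apply: (@le_trans _ _ ((C + 1) * (ct / 2 / (C + 1)))); last first.
    by rewrite mulrC divfK// gt_eqF.
  by rewrite ler_pM// ?lerDl// ltW.
move=> [[U V] /= [[m0 _ Um] V0] UV].
have /filter_ex [c [Vc c0]] : \forall c \near (0 : R)^'+, V c /\ 0 < c.
  by apply: filterI => //; exact: nbhs_right_gt.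
exists c, m0; split => // m t mm tT.
apply: (UV (m, c)); rewrite /= ?in_itv//.
by split=> //; exact: Um.
Qed.

End UniformCoercivity.

(** * Calculus of polynomial matrices and the truncated Lyapunov solution *)

Section PolynomialMatrices.
Variable R : realType.

Lemma evalpmx_map n (X : 'M[{poly R}]_n) t : evalpmx X t = map_mx (horner_eval t) X.
Proof. by []. Qed.

Lemma evalpmxD n (X Y : 'M[{poly R}]_n) t :
  evalpmx (X + Y) t = evalpmx X t + evalpmx Y t.
Proof. by rewrite !evalpmx_map map_mxD. Qed.

Lemma evalpmxB n (X Y : 'M[{poly R}]_n) t :
  evalpmx (X - Y) t = evalpmx X t - evalpmx Y t.
Proof. by rewrite !evalpmx_map map_mxB. Qed.

Lemma evalpmxM n (X Y : 'M[{poly R}]_n) t :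
  evalpmx (X *m Y) t = evalpmx X t *m evalpmx Y t.
Proof. by rewrite !evalpmx_map map_mxM. Qed.

Lemma evalpmxZ n p (X : 'M[{poly R}]_n) t :
  evalpmx (p *: X) t = p.[t] *: evalpmx X t.
Proof. by rewrite !evalpmx_map map_mxZ. Qed.

Lemma evalpmx_tr n (X : 'M[{poly R}]_n) t : evalpmx X^T t = (evalpmx X t)^T.
Proof. by rewrite /evalpmx map_trmx. Qed.

Lemma evalpmx_const n (X : 'M[R]_n) t : evalpmx (constpmx X) t = X.
Proof. by apply/matrixP => i j; rewrite !mxE hornerC. Qed.

Lemma derivpmxD n (X Y : 'M[{poly R}]_n) :
  derivpmx (X + Y) = derivpmx X + derivpmx Y.
Proof. by apply/matrixP => i j; rewrite !mxE derivD. Qed.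

Lemma derivpmxM n (X Y : 'M[{poly R}]_n) :
  derivpmx (X *m Y) = derivpmx X *m Y + X *m derivpmx Y.
Proof.
apply/matrixP => i j; rewrite !mxE raddf_sum -big_split /=.
by apply: eq_bigr => k _; rewrite !mxE derivM.
Qed.

Lemma derivpmx_tr n (X : 'M[{poly R}]_n) : derivpmx X^T = (derivpmx X)^T.
Proof. by rewrite /derivpmx map_trmx. Qed.

Lemma derivpmx_const n (X : 'M[R]_n) : derivpmx (constpmx X) = 0.
Proof. by apply/matrixP => i j; rewrite !mxE derivC. Qed.

Lemma derivpmxZ n p (X : 'M[R]_n) :
  derivpmx (p *: constpmx X) = p^`() *: constpmx X.
Proof. by apply/matrixP => i j; rewrite !mxE derivM derivC mulr0 addr0. Qed.

Lemma constpmxM n (X Y : 'M[R]_n) : constpmx (X *m Y) = constpmx X *m constpmx Y.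
Proof. by rewrite /constpmx map_mxM. Qed.

Lemma exppmxS n (A : 'M[R]_n) m : exppmx A m.+1 =
  exppmx A m + ((m`!%:R)^-1 *: 'X^m) *: constpmx (A ^+ m).
Proof. by rewrite /exppmx big_ord_recr. Qed.

Lemma exppmx_comm n (A : 'M[R]_n) m :
  exppmx A m *m constpmx A = constpmx A *m exppmx A m.
Proof.
rewrite /exppmx mulmx_suml mulmx_sumr; apply: eq_bigr => k _.
rewrite -scalemxAl -scalemxAr -!constpmxM; congr (_ *: constpmx _).
by rewrite -[LHS]/(A ^+ k * A) -[RHS]/(A * A ^+ k) -exprS exprSr.
Qed.

Lemma derivpmx_exppmx n (A : 'M[R]_n) m :
  derivpmx (exppmx A m.+1) = constpmx A *m exppmx A m.
Proof.
elim: m => [|m IH].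
  rewrite /exppmx big_ord1 big_ord0 mulmx0 derivpmxZ expr0.
  by rewrite derivZ derivC scaler0 scale0r.
rewrite exppmxS derivpmxD IH [in RHS]exppmxS mulmxDr; congr (_ + _).
rewrite derivpmxZ -scalemxAr -constpmxM -[A *m A ^+ m]/(A * A ^+ m) -exprS.
congr (_ *: _); rewrite derivZ derivXn /= -scalerMnr scalerMnl; congr (_ *: _).
by rewrite factS natrM invfM -mulr_natl mulrA mulfV ?mul1r// pnatr_eq0.
Qed.

(** [A] times the last term of the truncation with [m + 1] terms: the amount by which that
    truncation fails to solve [E' = A E]. *)
Definition exp_defect n (A : 'M[R]_n) (m : nat) : 'M[{poly R}]_n :=
  ((m`!%:R)^-1 *: 'X^m) *: constpmx (A ^+ m.+1).

Lemma derivpmx_exppmx_defect n (A : 'M[R]_n) m :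
  derivpmx (exppmx A m.+1) = constpmx A *m exppmx A m.+1 - exp_defect A m.
Proof.
rewrite derivpmx_exppmx exppmxS mulmxDr -scalemxAr -constpmxM.
by rewrite -[A *m A ^+ m]/(A * A ^+ m) -exprS addrK.
Qed.

(** The bound is a multiple of the general term of a convergent exponential series, hence tends to 0
    in [m], uniformly on [[0, T]]. *)
Lemma norm_exp_defect n (A : 'M[R]_n) (T : R) m t : 0 <= t <= T ->
  `|evalpmx (exp_defect A m) t| <=
  n%:R * `|A| * exp_coeff (T * (n%:R * `|A|)) m.
Proof.
move=> /andP[t0 tT]; rewrite evalpmxZ evalpmx_const normrZ hornerZ hornerXn.
rewrite ger0_norm ?mulr_ge0 ?invr_ge0 ?exprn_ge0// /exp_coeff /=.
rewrite exprMn mulrCA.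
apply: (@le_trans _ _ ((m`!%:R)^-1 * T ^+ m * (n%:R * `|A|) ^+ m.+1)).
  apply: ler_pM => //; first by rewrite mulr_ge0 ?invr_ge0 ?exprn_ge0.
    by rewrite ler_wpM2l ?invr_ge0// lerXn2r// nnegrE (le_trans t0 tT).
  exact: norm_exprmx.
rewrite exprS; move: (n%:R * `|A|) => x.
by rewrite le_eqVlt; apply/orP; left; apply/eqP; ring.
Qed.

(* A truncated [e^(A^T t) Q e^(A t)], which solves [S' = S A + A^T S] up to
   [exp_defect], plus a scalar term [s] that makes the inequality strict. *)
Definition lyap_pmx n (A Q : 'M[R]_n) (s : {poly R}) (m : nat) : 'M[{poly R}]_n :=
  (exppmx A m.+1)^T *m constpmx Q *m exppmx A m.+1 + s *: constpmx 1%:M.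

Lemma lyap_pmx_sym n (A Q : 'M[R]_n) s m : symmx Q -> symmx (lyap_pmx A Q s m).
Proof.
move=> sQ; rewrite /symmx /lyap_pmx [LHS]linearD /= [(_ *: _)^T]linearZ /=.
have cT (X : 'M[R]_n) : (constpmx X)^T = constpmx X^T by rewrite /constpmx map_trmx.
by rewrite !trmx_mul !cT trmxK sQ trmx1 mulmxA.
Qed.

Lemma lyap_pmx_eval0 n (A Q : 'M[R]_n) s m :
  evalpmx (lyap_pmx A Q s m) 0 = Q + s.[0]%:M.
Proof.
rewrite evalpmxD evalpmxZ !evalpmxM evalpmx_tr !evalpmx_const scalemx1.
have -> : evalpmx (exppmx A m.+1) 0 = 1%:M.
  rewrite evalpmx_exppmx big_ord_recl /= big1 => [|k _].
    by rewrite expr0 fact0 divr1 scale1r addr0.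
  by rewrite expr0n /= mul0r scale0r.
by rewrite trmx1 mul1mx mulmx1.
Qed.

(** [E] commutes with [A], so the terms without defect cancel. Only the scalar term and the two
    products containing [D] survive. *)
Lemma lyap_pmx_deriv n (A Q : 'M[R]_n) s m :
  let E := exppmx A m.+1 in let D := exp_defect A m in
  let S := lyap_pmx A Q s m in
  derivpmx S - (S *m constpmx A + (constpmx A)^T *m S) =
  (s^`() *: constpmx 1%:M - s *: constpmx (A + A^T))
  - (D^T *m constpmx Q *m E + E^T *m constpmx Q *m D).
Proof.
move=> E D S; rewrite /S /lyap_pmx -/E derivpmxD !derivpmxM derivpmx_tr.
rewrite derivpmx_const mulmx0 addr0 derivpmx_exppmx_defect -/E -/D derivpmxZ.
rewrite linearB /= trmx_mul !(mulmxBl, mulmxBr, mulmxDl, mulmxDr) ?mulmxN.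
rewrite -(mulmxA _ E (constpmx A)) exppmx_comm !mulmxA -/E.
have -> : constpmx (A + A^T) = constpmx A + (constpmx A)^T.
  by rewrite /constpmx map_mxD map_trmx.
have -> : constpmx 1%:M = 1%:M :> 'M[{poly R}]_n.
  by rewrite /constpmx map_scalar_mx.
rewrite -scalemxAl -[_^T *m (s *: _)]scalemxAr mul1mx mulmx1 scalerDr.
rewrite [E^T *m (constpmx A)^T](_ : _ = (constpmx A)^T *m E^T); last first.
  by rewrite -!trmx_mul exppmx_comm.
move: ((constpmx A)^T *m E^T *m constpmx Q *m E) => u.
move: (D^T *m constpmx Q *m E) => v.
move: (E^T *m constpmx Q *m constpmx A *m E) => w.
move: (E^T *m constpmx Q *m D) => x.
move: (s *: constpmx A) (s *: (constpmx A)^T) => y z.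
by apply/matrixP => i j; rewrite !mxE; ring.
Qed.

End PolynomialMatrices.

(** * The constraints for a single index *)

(** Once the [P_j] and [Pi] are fixed, the sum over [j] is a given matrix [Q] and the constraints
    for distinct [i] decouple. The degree bound is left out, since [d] is chosen after all blocks
    are solved. *)
Definition sos_block (R : realType) (n : nat) (A J P Q : 'M[R]_n)
    (Tmin Tmax eps : R) (S G D : 'M[{poly R}]_n) : Prop :=
  [/\ symmx S, sosmx G, sosmx D
    & [/\ sosmx (constpmx (P - eps%:M)),
          sosmx (derivpmx S - (S *m constpmx A + (constpmx A)^T *m S)
                 - gpoly Tmax *: G),
          sosmx (constpmx P - (constpmx J)^T *m S *m constpmx J
                 - constpmx eps%:M - hpoly Tmin Tmax *: D)
        & sosmx (constpmx (- Q + evalpmx S 0))]].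

Section Block.
Local Open Scope classical_set_scope.
Variable R : realType.

Lemma coercmx_sub_scalar n (X : 'M[R]_n) c e :
  coercmx c X -> coercmx (c - e) (X - e%:M).
Proof.
by move=> cX x; rewrite mulrBl qformB -(scalemx1 _ e) qformZ lerB.
Qed.

Lemma posdefmx_opp n (X P : 'M[R]_n) : negdefmx (X - P) -> posdefmx (P - X).
Proof.
move=> [sX nX]; split; first by rewrite /symmx -opprB linearN /= sX.
move=> x x0; rewrite -[X in _ < X]/(qform _ x) -opprB qformN oppr_gt0.
exact: nX.
Qed.

(** With [s = d (1 + t)^(K + 1)] and [k = n |A + A^T|], the matrix [s' I - s (A + A^T)] is at least
    [d (1 + t)^K (K + 1 - k (1 + t)) I]; the condition on [K] makes the last factor at least 1. *)
Lemma coercmx_growth n (A : 'M[R]_n) (T d t : R) K :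
  0 <= t <= T -> 0 <= d -> n%:R * `|A + A^T| * (1 + T) + 1 <= K.+1%:R ->
  coercmx d ((d * K.+1%:R * (1 + t) ^+ K)%:M - (d * (1 + t) ^+ K.+1) *: (A + A^T)).
Proof.
move=> /andP[t0 tT] d0 hK x; rewrite -[(_ * _)%:M]scalemx1 qformB !qformZ.
have := le_trans (ler_norm _) (qform_norm (A + A^T) x).
set k := n%:R * _; set q := qform _ x; set q1 := qform 1%:M x => kq.
have q10 : 0 <= q1 by exact: qform1_ge0.
have k0 : 0 <= k by rewrite mulr_ge0.
have p1 : 1 <= (1 + t) ^+ K by rewrite exprn_ege1// lerDl.
apply: (@le_trans _ _ (d * (1 + t) ^+ K * (K.+1%:R - k * (1 + t)) * q1)).
  rewrite ler_wpM2r//; apply: (@le_trans _ _ (d * 1 * 1)); first by rewrite !mulr1.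
  apply: ler_pM => //; first by rewrite mulr1.
    by rewrite ler_wpM2l.
  rewrite lerBrDr addrC; apply: le_trans hK; rewrite lerD2r ler_wpM2l// lerD2l//.
have -> : d * (1 + t) ^+ K * (K.+1%:R - k * (1 + t)) * q1 =
   d * K.+1%:R * (1 + t) ^+ K * q1 - d * (1 + t) ^+ K.+1 * (k * q1).
  by rewrite exprS; move: ((1 + t) ^+ K) (K.+1%:R) => u v; ring.
rewrite lerB// ler_wpM2l// mulr_ge0// exprn_ge0// addr_ge0//.
Qed.

Lemma horner_growth (d : R) K t :
  (d *: (1 + 'X) ^+ K).[t] = d * (1 + t) ^+ K.
Proof. by rewrite !hornerE. Qed.

Lemma horner_deriv_growth (d : R) K t :
  (d *: (1 + 'X) ^+ K.+1)^`().[t] = d * K.+1%:R * (1 + t) ^+ K.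
Proof.
rewrite derivZ deriv_exp derivD derivX -polyC1 derivC add0r polyC1 mul1r.
by rewrite hornerZ hornerMn horner_exp !hornerE -mulr_natl mulrA.
Qed.

(** The scalar term contributes [d], and the assumption on [m] lets the defect terms consume at most
    half of it. *)
Lemma lyap_pmx_deriv_coercive n (A Q : 'M[R]_n) (T d t : R) K m :
  let b := T * (n%:R * `|A|) in
  let S := lyap_pmx A Q (d *: (1 + 'X) ^+ K.+1) m in
  0 <= t <= T -> 0 <= d -> n%:R * `|A + A^T| * (1 + T) + 1 <= K.+1%:R ->
  n%:R * (n%:R ^+ 2 * `|Q| * expR b * (n%:R * `|A|) * 2) * exp_coeff b m <= d / 2 ->
  coercmx (d / 2)
    (evalpmx (derivpmx S - (S *m constpmx A + (constpmx A)^T *m S)) t).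
Proof.
move=> b S tT d0 rK mB; rewrite lyap_pmx_deriv.
rewrite 2!evalpmxB !evalpmxZ !evalpmx_const scalemx1.
rewrite horner_deriv_growth horner_growth.
have -> : d / 2 = d - d / 2 by lra.
apply: coercmx_perturb; first exact: coercmx_growth tT d0 rK.
rewrite addrC addrA addNr add0r normrN; apply: le_trans mB.
rewrite -mulrA ler_wpM2l// evalpmxD !evalpmxM !evalpmx_tr evalpmx_const.
have := norm_exppmx_le A m.+1 tT; have := norm_exp_defect A m tT.
rewrite -/b; set E := evalpmx (exppmx A m.+1) t; set D := evalpmx (exp_defect A m) t.
move=> hD hE.
have h (X Y : 'M[R]_n) x y : `|X| <= x -> `|Y| <= y ->
    `|X^T *m Q *m Y| <= n%:R ^+ 2 * `|Q| * x * y.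
  move=> Xx Yy; apply: le_trans (norm_mulmx3 _ _ _) _; rewrite norm_trmx.
  rewrite [_ * _ * `|Q|]mulrAC.
  by apply: ler_pM => //; rewrite ?ler_wpM2l// ?mulr_ge0// exprn_ge0.
apply: le_trans (ler_normD _ _) _.
apply: le_trans (lerD (h _ _ _ _ hD hE) (h _ _ _ _ hE hD)) _.
move: (expR b) (exp_coeff b m) (n%:R * `|A|) (n%:R ^+ 2 * `|Q|) => x1 x2 x3 x4.
by rewrite le_eqVlt; apply/orP; left; apply/eqP; ring.
Qed.

(** The constants are chosen in the order [c] and [m0] (compactness), [K] (from [A]), [d] small, [m]
    large. Feasibility for every [eps] below a threshold is what allows a common [eps] for all
    indices. *)
Lemma sos_block_feasible n (A J P Q : 'M[R]_n) (Tmin Tmax : R) :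
  0 < Tmin -> Tmin <= Tmax -> posdefmx P -> symmx Q ->
  (forall t, Tmin <= t <= Tmax ->
    negdefmx (J^T *m expmx (t *: A^T) *m Q *m expmx (t *: A) *m J - P)) ->
  exists2 e0 : R, 0 < e0 & forall eps, eps <= e0 ->
    exists S G D, sos_block A J P Q Tmin Tmax eps S G D.
Proof.
move=> Tmin0 TT pP sQ neg.
have Tmax0 : 0 < Tmax by exact: lt_le_trans TT.
have pd t : Tmin <= t <= Tmax ->
    posdefmx (P - J^T *m (expmx (t *: A))^T *m Q *m expmx (t *: A) *m J).
  by move=> tT; rewrite -expmx_tr linearZ /=; exact/posdefmx_opp/neg.
have [c [m0 [c0 hc]]] := coercmx_uniform_exppmx (ltW Tmin0) pd.
have [cP cP0 hP] := posdef_coercive pP.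
pose r := n%:R * `|A + A^T| * (1 + Tmax) + 1.
have r0 : 0 <= r by rewrite addr_ge0 ?mulr_ge0// addr_ge0// ltW.
pose K := Num.bound r.
have rK : r <= K.+1%:R.
  by apply: le_trans (ltW (archi_boundP r0)) _; rewrite ler_nat.
(* So small that [s(t) J^T J] costs at most [c / 4] of coercivity on [[0, Tmax]]. *)
pose d := c / 4 / (n%:R * `|J^T *m J| * (1 + Tmax) ^+ K.+1 + 1).
have z0 : 0 < n%:R * `|J^T *m J| * (1 + Tmax) ^+ K.+1 + 1.
  apply: ltr_wpDl => //; apply: mulr_ge0; first by rewrite mulr_ge0.
  by rewrite exprn_ge0// addr_ge0// ltW.
have d0 : 0 < d by rewrite !divr_gt0.
pose s : {poly R} := d *: (1 + 'X) ^+ K.+1.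
have sE t : s.[t] = d * (1 + t) ^+ K.+1 by exact: horner_growth.
pose b := Tmax * (n%:R * `|A|).
pose B := n%:R * (n%:R ^+ 2 * `|Q| * expR b * (n%:R * `|A|) * 2).
have B0 : 0 <= B by rewrite !mulr_ge0 ?exprn_ge0 ?expR_ge0.
(* [lyap_pmx] of order [m] uses the truncation with [m + 1] terms, whence [m0 <= m + 1]. The second
   bound holds for large [m] because the terms of the exponential series tend to 0. *)
have [m [mm0 mB]] : exists m, (m0 <= m.+1)%N /\ B * exp_coeff b m <= d / 2.
  have e0 : 0 < d / 2 / (B + 1) by rewrite !divr_gt0// ltr_wpDl.
  have /cvgrPdist_lt/(_ _ e0) := cvg_series_cvg_0 (is_cvg_series_exp_coeff b).
  move=> [m1 _ h]; exists (maxn m0 m1); split.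
    by rewrite leqW// leq_maxl.
  have := h _ (leq_maxr m0 m1); rewrite /= sub0r normrN.
  set u := exp_coeff b _ => hu.
  apply: (@le_trans _ _ ((B + 1) * (d / 2 / (B + 1)))); last first.
    by rewrite mulrC divfK// gt_eqF// ltr_wpDl.
  apply: (@le_trans _ _ (B * `|u|)); first by rewrite ler_wpM2l// ler_norm.
  by rewrite ler_pM// ?lerDl// ltW.
pose S := lyap_pmx A Q s m.
have sS : symmx S by exact: lyap_pmx_sym.
have cT (X : 'M[R]_n) : (constpmx X)^T = constpmx X^T by rewrite /constpmx map_trmx.
pose F1 := derivpmx S - (S *m constpmx A + (constpmx A)^T *m S).
have sF1 : symmx F1.
  rewrite /symmx /F1 [LHS]linearB /= -derivpmx_tr sS [(_ + _)^T]linearD /=.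
  by rewrite !trmx_mul trmxK sS [X in _ - X]addrC.
have cF1 t : 0 <= t <= Tmax -> coercmx (d / 2) (evalpmx F1 t).
  by move=> tT; exact: lyap_pmx_deriv_coercive tT (ltW d0) rK mB.
have d2 : 0 < d / 2 by rewrite divr_gt0.
have [G sG hG] := sosmx_interval d2 (ltW Tmax0) sF1 cF1.
(* [c / 4] leaves [c - c / 4 - eps >= c / 2] in the jump condition; [cP / 2] keeps [P - eps I]
   positive definite. *)
exists (Num.min (c / 4) (cP / 2)); first by rewrite lt_min !divr_gt0.
move=> eps; rewrite le_min => /andP[ec ecP].
pose F2 := constpmx P - (constpmx J)^T *m S *m constpmx J - constpmx eps%:M.
have sF2 : symmx F2.
  rewrite /symmx /F2 !linearB /= !trmx_mul !cT trmxK sS tr_scalar_mx pP.1.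
  by rewrite mulmxA.
have cF2 t : Tmin <= t <= Tmax -> coercmx (c / 2) (evalpmx F2 t).
  move=> tT; have := hc _ t mm0 tT.
  have /andP[t1 t2] := tT; have t0 : 0 <= t by apply: le_trans t1; exact: ltW.
  rewrite /F2 2!evalpmxB !evalpmxM cT !evalpmx_const evalpmxD evalpmxZ.
  rewrite !evalpmxM evalpmx_tr !evalpmx_const sE mulmxDr mulmxDl !mulmxA.
  set U := _ *m J => hU.
  have -> : J^T *m ((d * (1 + t) ^+ K.+1) *: 1%:M) *m J =
      (d * (1 + t) ^+ K.+1) *: (J^T *m J).
    by rewrite scalemx1 mul_mx_scalar scalemxAl.
  apply: (@coercmx_le _ _ (c - c / 4 - eps)); first by lra.
  apply: coercmx_sub_scalar; apply: (coercmx_perturb hU).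
  have -> : forall W, P - (U + W) - (P - U) = - W.
    by move=> W; rewrite !opprD opprK addrACA subrr add0r addrAC addNr add0r.
  rewrite normrN normrZ ger0_norm; last first.
    by rewrite mulr_ge0 ?(ltW d0)// exprn_ge0// addr_ge0.
  apply: (@le_trans _ _ (d * (n%:R * `|J^T *m J| * (1 + Tmax) ^+ K.+1 + 1))); last first.
    by rewrite divfK// gt_eqF.
  have ac (u v w z : R) : u * (v * w * z) = v * (u * z * w) by ring.
  rewrite [leLHS](_ : _ = d * (n%:R * `|J^T *m J| * (1 + t) ^+ K.+1)); last exact: ac.
  rewrite ler_wpM2l ?(ltW d0)// ler_wpDr// ler_wpM2l ?mulr_ge0//.
  by rewrite lerXn2r ?nnegrE ?addr_ge0 ?(ltW Tmax0)// lerD2l.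
have c2 : 0 < c / 2 by rewrite divr_gt0.
have [D sD hD] := sosmx_interval c2 TT sF2 cF2.
exists S, G, D; split=> //; split=> //.
- apply: sosmx_const; apply: (coercmx_posdef _ _ (coercmx_sub_scalar eps hP)).
    by move: ecP cP0; clear; lra.
  by rewrite /symmx linearB /= tr_scalar_mx pP.1.
- by move: hG; rewrite polyC0 subr0.
(* The truncation is the identity at time 0, so [S(0) - Q] is exactly [s(0) I = d I]. *)
- rewrite lyap_pmx_eval0 addrA addNr add0r; apply: sosmx_const.
  have s0 : 0 < s.[0] by rewrite sE addr0 expr1n mulr1.
  apply: (coercmx_posdef s0); first by rewrite /symmx tr_scalar_mx.
  by move=> x; rewrite -[s.[0]%:M]scalemx1 qformZ.
Qed.

End Block.

(** * Assembly over all indices *)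

Theorem proposition8 (R : realType) (n N : nat) (A : 'M[R]_n)
    (J : 'I_N -> 'M[R]_n) (Tmin Tmax : R)
    (Tmin_gt0 : 0 < Tmin) (Tmin_le_Tmax : Tmin <= Tmax)
    (P_Pi_exist : exists (P : 'I_N -> 'M[R]_n) (Pi : 'M[R]_N),
       [/\ forall i : 'I_N, posdefmx (P i),
           colstochmx Pi
         & forall (i : 'I_N) (theta : R), Tmin <= theta <= Tmax ->
             negdefmx ((J i)^T *m expmx (theta *: A^T)
                       *m (\sum_(j < N) Pi j i *: P j)
                       *m expmx (theta *: A) *m J i - P i)]) :
  exists (eps : R) (d : nat),
    0 < eps /\ sos_feasible A J Tmin Tmax eps d.
Proof.
have [P [Pi [pP stPi neg]]] := P_Pi_exist.
have sQ i : symmx (\sum_(j < N) Pi j i *: P j).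
  rewrite /symmx linear_sum; apply: eq_bigr => j _.
  by rewrite linearZ /= (pP j).1.
have /choice [e he] : forall i, exists e : R, 0 < e /\ forall eps, eps <= e ->
    exists S G D, sos_block A (J i) (P i) (\sum_(j < N) Pi j i *: P j)
      Tmin Tmax eps S G D.
  move=> i; have [e e0 he] :=
    sos_block_feasible Tmin_gt0 Tmin_le_Tmax (pP i) (sQ i) (neg i).
  by exists e.
(* The default value 1 keeps [eps] positive when [N = 0]. *)
pose eps := \big[Num.min/1]_i e i.
have eps0 : 0 < eps by apply: lt_bigmin => // i _; exact: (he i).1.
have eps_le i : eps <= e i by exact: bigmin_le.
have /choice [W hW] : forall i, exists W : 'M[{poly R}]_n * 'M[{poly R}]_n * 'M[{poly R}]_n,
      sos_block A (J i) (P i) (\sum_(j < N) Pi j i *: P j)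
        Tmin Tmax eps W.1.1 W.1.2 W.2.
  by move=> i; have [S [G [D h]]] := (he i).2 _ (eps_le i); exists (S, G, D).
pose sz (X : 'M[{poly R}]_n) := (\max_j \max_k size (X j k))%N.
(* A crude choice: [d] bounds the size of every entry of every unknown, so all degrees are at most
   [2 d]. *)
pose d := (\max_i maxn (sz (W i).1.1) (maxn (sz (W i).1.2) (sz (W i).2)))%N.
have degW (X : 'M[{poly R}]_n) : (sz X <= d)%N -> degpmx_le (2 * d) X.
  move=> Xd j k; apply: leq_trans (leq_trans (leq_trans Xd _) (leqnSn _)).
    apply: leq_trans (leq_bigmax j).
    exact: (leq_bigmax (F := fun k => size (X j k)) k).
  by rewrite mul2n -addnn leq_addr.
have dW i : (maxn (sz (W i).1.1) (maxn (sz (W i).1.2) (sz (W i).2)) <= d)%N.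
  exact: (leq_bigmax (F := fun i => maxn _ (maxn _ _)) i).
exists eps, d; split=> //.
exists (fun i => (W i).1.1), (fun i => (W i).1.2), (fun i => (W i).2), P, Pi.
split=> // i; move: (dW i) (hW i); rewrite !geq_max.
case: (W i) => [[X G] D] /= /and3P[dX dG dD] [sX sG sD hXGD].
split=> //; first by split=> //; [exact: sosmx_sym|exact: sosmx_sym|exact: (pP i).1].
by split; exact: degW.
Qed.
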